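(* Let $\rho:\Gamma\to G$ be a $(P^+,P^-)$-Anosov representation whose domain of discontinuity $M:=\Omega_\rho$ is a complex curve, and let $F^{ab}$ be the free abelian group generated by the holomorphic line bundles $\mathcal{E}^g=g^*T^{1,0}M$, $g\in\rho(\Gamma)$, as in the context. Then $\rho(\Gamma)$ acts as a group of automorphisms on the free abelian group $F^{ab}$. Moreover, $F^{ab}$ has a structure of non-trivial topological space so that the action of $\rho(\Gamma)$ is properly discontinuous on $F^{ab}\setminus\{\mathcal{O}\}$.
   Context: Anosov representations. $\Gamma$ is a finitely generated word hyperbolic group with boundary at infinity $\partial_\infty\Gamma$, and $\partial_\infty\Gamma^{(2)}=\partial_\infty\Gamma\times\partial_\infty\Gamma\setminus\{(t,t): t\in\partial_\infty\Gamma\}$. $G$ is a semisimple Lie group, $(P^+,P^-)$ is a pair of opposite parabolic subgroups, and $\mathcal{F}^\pm=G/P^\pm$. A pair in $\mathcal{F}^+\times\mathcal{F}^-$ is transverse if it lies in the unique open $G$-orbit of the diagonal action (this orbit is $\cong G/(P^+\cap P^-)$). $\hat\Gamma$ is the (essentially unique) proper hyperbolic metric space with an action of $\Gamma\times(\mathbb{R}\rtimes\mathbb{Z}/2\mathbb{Z})$ such that $\Gamma\times\mathbb{Z}/2\mathbb{Z}$ acts isometrically, every orbit map $\Gamma\to\hat\Gamma$ is a quasi-isometry, the $\mathbb{R}$-action $\phi_t$ is free with quasi-isometrically embedded orbits, and the map $(\tau^+,\tau^-):\hat\Gamma\to\partial_\infty\Gamma^{(2)}$ sending a point to the endpoints of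 its $\mathbb{R}$-orbit induces a homeomorphism $\hat\Gamma/\mathbb{R}\cong\partial_\infty\Gamma^{(2)}$. A representation $\rho:\Gamma\to G$ is $(P^+,P^-)$-Anosov if there are continuous $\rho$-equivariant maps $\xi^\pm:\partial_\infty\Gamma\to\mathcal{F}^\pm$ such that (1) $(\xi^+(t^+),\xi^-(t^-))$ is transverse for all $(t^+,t^-)\in\partial_\infty\Gamma^{(2)}$; (2) for one (hence any) continuous equivariant family of norms $\|\cdot\|_{\hat m}$, $\hat m\in\hat\Gamma$, on $T_{\xi^+(\tau^+(\hat m))}\mathcal{F}^+$ (resp. $T_{\xi^-(\tau^-(\hat m))}\mathcal{F}^-$) there are $A,a>0$ with $\|e\|_{\phi_{-t}(\hat m)}\le Ae^{-at}\|e\|_{\hat m}$ (resp. $\|e\|_{\phi_t(\hat m)}\le Ae^{-at}\|e\|_{\hat m}$) for all $t\ge0$, all $\hat m\in\hat\Gamma$ and all $e$ in the corresponding tangent space. Domain of discontinuity. $\mathcal{X}=G/H$ with $H$ a parabolic or a symmetric subgroup of $G$. $M=\Omega_\rho\subset\mathcal{X}$ is a domain of discontinuity for $\rho$: an open $\rho(\Gamma)$-invariant subset such that for every compact $K\subset\Omega_\rho$ the set $\{\gamma\in\Gamma:\rho(\gamma)K\cap K\ne\emptyset\}$ is finite. It is assumed to be a complex curve (complex dimension $1$), with elements of $\rho(\Gamma)$ acting on it by biholomorphisms. An action of $\rho(\Gamma)$ on a topological space $X$ is properly discontinuous if for every compact $K\subset X$ the set $\{\gamma\in\Gamma:\rho(\gamma)K\cap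 K\neq\emptyset\}$ is finite. The group $F^{ab}$. On $\rho(\Gamma)$ put $g\sim g'$ iff $g(m)=g'(m)$ for all $m\in M$, and let $\overline{\rho(\Gamma)}=\rho(\Gamma)/\sim$. The line bundle $\mathcal{E}^g=g^*T^{1,0}M$ is the pullback by $g:M\to M$ of the $(1,0)$-part of $TM\otimes_{\mathbb{R}}\mathbb{C}$; it depends only on the class $[g]$, and each equivalence class gives one generator. $F$ is the group of formal tensor products of the symbols $\mathcal{E}^g$, the duals $(\mathcal{E}^g)^*$, and the trivial line bundle $\mathcal{O}$ ($[g]\in\overline{\rho(\Gamma)}$), subject only to the identifications in which a bundle cancels against its adjacent dual (giving $\mathcal{O}$) and $\mathcal{O}$ is neutral for $\otimes$; i.e. $F$ is the free group on $\{\mathcal{E}^g\}_{[g]\in\overline{\rho(\Gamma)}}$ with group operation $\otimes$, identity $\mathcal{O}$ and inverses given by duals. $F^{ab}$ is its abelianization, the free abelian group on $\{\mathcal{E}^g\}_{[g]\in\overline{\rho(\Gamma)}}$ with identity $\mathcal{O}$; its elements are identified with reduced expressions (no canceling pairs). The action of $g'\in\rho(\Gamma)$ is given by $g'\cdot\mathcal{O}=\mathcal{O}$ and by replacing, in a reduced expression, each factor $\mathcal{E}^{g}$ by $\mathcal{E}^{g'g}$ and each factor $(\mathcal{E}^g)^*$ by $(\mathcal{E}^{g'g})^*$. *)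

(* Defs.v *)
From HB Require Import structures.
From mathcomp Require Import all_boot all_order all_algebra.
From mathcomp Require Import complex.
From mathcomp Require Import freeg.
From mathcomp Require Import all_classical all_reals all_analysis.

Set Implicit Arguments.
Unset Strict Implicit.
Unset Printing Implicit Defensive.

Import Order.TTheory GRing.Theory Num.Theory.
Import numFieldTopology.Exports numFieldNormedType.Exports.

Local Open Scope classical_set_scope.
Local Open Scope complex_scope.
Local Open Scope ring_scope.

Section GromovHyperbolic.
Context {R : realType} {T : Type} (d : T -> T -> R).

Definition gromov_product (o x y : T) : R := (d x o + d y o - d x y) / 2.

(* Gromov's four-point condition; it does not require the space to be
   geodesic, so it applies to a group with a word metric. *)
Definition gromov_hyperbolic : Prop :=
  exists delta : R, forall o x y z,
    Num.min (gromov_product o x y) (gromov_product o y z) - delta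
      <= gromov_product o x z.

Definition qi_embedding {T' : Type} (d' : T' -> T' -> R) (f : T -> T') : Prop :=
  exists K C : R, [/\ 1 <= K, 0 <= C &
    forall x y, d x y / K - C <= d' (f x) (f y) <= K * d x y + C].

Definition quasi_isometry {T' : Type} (d' : T' -> T' -> R) (f : T -> T') :=
  qi_embedding d' f /\ exists C : R, forall y, exists x, d' (f x) y <= C.

(* (x_m | y_n)_o tends to infinity as m, n do *)
Definition asymptotic (o : T) (s t : nat -> T) : Prop :=
  forall r : R, \forall m \near \oo & n \near \oo,
    r <= gromov_product o (s m) (t n).

(* a sequence converges to infinity when it is asymptotic to itself *)
Definition boundary_class (o : T) (c : set (nat -> T)) : Prop :=
  exists2 s, asymptotic o s s
           & c = [set t | asymptotic o t t /\ asymptotic o s t].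

Definition gromov_boundary (o : T) : Type :=
  {c : set (nat -> T) | boundary_class o c}.

End GromovHyperbolic.

Section BoundaryTopology.
Context {R : realType} {T : Type} (d : T -> T -> R) (o : T).
Local Notation bd := (gromov_boundary d o).

(* points represented by sequences whose Gromov products with some sequence
   representing p are eventually at least r *)
Definition boundary_nbhd (p : bd) (r : R) : set bd :=
  [set q | exists s t, [/\ sval p s, sval q t &
     \forall m \near \oo & n \near \oo, r <= gromov_product d o (s m) (t n)]].

Definition boundary_open (W : set bd) : Prop :=
  forall p, W p -> exists r, boundary_nbhd p r `<=` W.

Lemma boundary_openT : boundary_open setT.
Proof. by move=> p _; exists 0. Qed.

Lemma boundary_openI : setI_closed boundary_open.
Proof.
move=> A B oA oB p [/oA[r rA] /oB[r' rB]]; exists (Num.max r r').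
by move=> q [s [t [ps qt [[/= P Q] PQ H]]]]; split; [apply: rA|apply: rB];
  exists s, t; split => //; exists (P, Q) => // z /H /=; apply: le_trans;
  rewrite le_max lexx ?orbT.
Qed.

Lemma boundary_open_bigU (I : Type) (f : I -> set bd) :
  (forall i, boundary_open (f i)) -> boundary_open (\bigcup_i f i).
Proof.
by move=> fo p [i _ /fo[r rf]]; exists r => q /rf fq; exists i.
Qed.

HB.instance Definition _ := gen_eqMixin bd.
HB.instance Definition _ := gen_choiceMixin bd.
HB.instance Definition _ := isOpenTopological.Build bd
  boundary_openT boundary_openI boundary_open_bigU.

End BoundaryTopology.

Section WordMetric.
Context {R : realType} {Gam : groupType} (S : seq Gam).

Definition spells (w : seq Gam) (x : Gam) : Prop :=
  all (fun s => (s \in S) || (s^-1%g \in S)) w /\ x = (\prod_(s <- w) s)%g.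

Definition generates : Prop := forall x, exists w, spells w x.

Definition word_dist (x y : Gam) : R :=
  inf [set (size w)%:R | w in [set w | spells w (x^-1 * y)%g]].

Definition word_hyperbolic : Prop := gromov_hyperbolic word_dist.

Definition group_boundary : Type := gromov_boundary word_dist 1%g.

HB.instance Definition _ := Topological.on group_boundary.

(* q = g . p *)
Definition boundary_translate (g : Gam) (p q : group_boundary) : Prop :=
  forall s, sval p s -> sval q (fun n => (g * s n)%g).

End WordMetric.

Section FlowSpace.
Context {R : realType} {Gam : groupType} (S : seq Gam).
Local Notation bd := (@group_boundary R Gam S).

Record flow_space (Y : metricType R) := FlowSpace {
  fs_act : Gam -> Y -> Y;
  fs_flow : R -> Y -> Y;
  fs_flip : Y -> Y;
  fs_pos : Y -> bd;
  fs_neg : Y -> bd;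
  fs_proper : forall (y : Y) (r : R), compact [set z | mdist y z <= r];
  fs_hyperbolic : gromov_hyperbolic (@mdist R Y);
  fs_act1 : forall y, fs_act 1%g y = y;
  fs_actM : forall g h y, fs_act (g * h)%g y = fs_act g (fs_act h y);
  fs_flow0 : forall y, fs_flow 0 y = y;
  fs_flowD : forall s t y, fs_flow (s + t) y = fs_flow s (fs_flow t y);
  fs_flipK : involutive fs_flip;
  fs_flip_flow : forall t y, fs_flip (fs_flow t y) = fs_flow (- t) (fs_flip y);
  fs_act_flow : forall g t y, fs_act g (fs_flow t y) = fs_flow t (fs_act g y);
  fs_act_flip : forall g y, fs_act g (fs_flip y) = fs_flip (fs_act g y);
  fs_act_isometry : forall g y z, mdist (fs_act g y) (fs_act g z) = mdist y z;
  fs_flip_isometry : forall y z, mdist (fs_flip y) (fs_flip z) = mdist y z;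
  fs_flow_continuous : continuous (fun p : R * Y => fs_flow p.1 p.2);
  fs_orbit_qi : forall y,
    quasi_isometry (word_dist S) (@mdist R Y) (fs_act ^~ y);
  fs_flow_free : forall t y, fs_flow t y = y -> t = 0;
  fs_flow_qi : forall y,
    qi_embedding (fun s t : R => `|s - t|) (@mdist R Y) (fs_flow ^~ y);
  (* the endpoints of a flow line, transported to the boundary of Gam by the
     orbit map of y *)
  fs_posP : forall y s, sval (fs_pos y) s ->
    asymptotic (@mdist R Y) y (fun n => fs_act (s n) y)
                              (fun n => fs_flow n%:R y);
  fs_negP : forall y s, sval (fs_neg y) s ->
    asymptotic (@mdist R Y) y (fun n => fs_act (s n) y)
                              (fun n => fs_flow (- n%:R) y);
  (* Y / R is homeomorphic to the space of pairs of distinct points *)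
  fs_fiber : forall y z, (fs_pos y = fs_pos z /\ fs_neg y = fs_neg z) <->
    exists t, z = fs_flow t y;
  fs_image : forall p q, p <> q <-> exists y, fs_pos y = p /\ fs_neg y = q;
  fs_homeo : forall W : set (bd * bd), W `<=` [set p | p.1 <> p.2] ->
    open [set y | W (fs_pos y, fs_neg y)] <->
    exists2 O, open O & W = O `&` [set p | p.1 <> p.2]
}.

End FlowSpace.

Section Smooth.
Context {R : realType}.

(* class C^k on the open set U *)
Fixpoint class_C {n m : nat} (k : nat) (U : set 'rV[R]_n)
    (f : 'rV[R]_n -> 'rV[R]_m) : Prop :=
  if k is k'.+1 then
    forall v, (forall x, U x -> derivable f x v) /\
              class_C k' U (fun x => 'D_v f x)
  else forall x, U x -> {for x, continuous f}.

Definition smooth {n m : nat} (U : set 'rV[R]_n) (f : 'rV[R]_n -> 'rV[R]_m) :=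
  forall k, class_C k U f.

End Smooth.

(* Charts with values in R^n; [param i] is the inverse of [coord i] and is
   only meaningful on [coord i @` dom i]. *)
Record atlas (R : realType) (T : Type) (n : nat) := Atlas {
  chart : Type;
  dom : chart -> set T;
  coord : chart -> T -> 'rV[R]_n;
  param : chart -> 'rV[R]_n -> T
}.
Arguments dom {R T n} A i : rename.
Arguments coord {R T n} A i x : rename.
Arguments param {R T n} A i u : rename.

Section Manifold.
Context {R : realType}.

(* [A] is a smooth atlas of the open subset [U] of [T] *)
Definition smooth_atlas {T : topologicalType} {n} (U : set T)
    (A : atlas R T n) : Prop :=
  [/\ \bigcup_i dom A i = U,
      forall i, [/\ open (dom A i), open (coord A i @` dom A i) &
        forall x, dom A i x -> param A i (coord A i x) = x],
      forall i x, dom A i x -> {for x, continuous (coord A i)} /\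
        {for coord A i x, continuous (param A i)} &
      forall i j, smooth (coord A i @` (dom A i `&` dom A j))
                         (coord A j \o param A i)].

Definition smooth_manifold {T : topologicalType} {n} (A : atlas R T n) : Prop :=
  [/\ hausdorff_space T, @second_countable T & smooth_atlas setT A].

Definition smooth_map {T T' : topologicalType} {n n'} (A : atlas R T n)
    (B : atlas R T' n') (U : set T) (f : T -> T') : Prop :=
  (forall x, U x -> {for x, continuous f}) /\
  forall i j, smooth (coord A i @` (U `&` dom A i `&` f @^-1` dom B j))
                     (coord B j \o f \o param A i).

(* A tangent vector at x is the family of its coordinates in all the charts
   around x (with the value 0 in the other charts). *)
Definition tangent {T : Type} {n} (A : atlas R T n) (x : T) :
    set (chart A -> 'rV[R]_n) :=
  [set v | (forall i, ~ dom A i x -> v i = 0) /\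
    forall i j, dom A i x -> dom A j x ->
      v j = 'D_(v i) (coord A j \o param A i) (coord A i x)].

(* the tangent vector at x with coordinates u in the chart i *)
Definition tangent_of {T : Type} {n} (A : atlas R T n) (i : chart A) (x : T)
    (u : 'rV[R]_n) : chart A -> 'rV[R]_n :=
  fun j => if `[< dom A j x >]
           then 'D_u (coord A j \o param A i) (coord A i x) else 0.

Arguments tangent {T n} A x.
Arguments tangent_of {T n} A i x u.

(* w is the image of v by the differential of f at x *)
Definition pushes {T T' : Type} {n n'} (A : atlas R T n) (B : atlas R T' n')
    (f : T -> T') (x : T) (v : chart A -> 'rV[R]_n) (w : chart B -> 'rV[R]_n') :
    Prop :=
  [/\ tangent A x v, tangent B (f x) w &
    forall i j, dom A i x -> dom B j (f x) ->
      w j = 'D_(v i) (coord B j \o f \o param A i) (coord A i x)].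

Arguments pushes {T T' n n'} A B f x v w.

End Manifold.
Arguments tangent {R T n} A x.
Arguments tangent_of {R T n} A i x u.
Arguments pushes {R T T' n n'} A B f x v w.

#[short(type="topGroupType")]
HB.structure Definition TopGroup := {G of Group G & Topological G}.

Section LinearSpan.
Context {R : realType} {V : lmodType R}.

Definition span (E : set V) : set V :=
  [set v | exists (n : nat) (a : 'I_n -> R) (w : 'I_n -> V),
     (forall k, E (w k)) /\ v = \sum_k a k *: w k].

End LinearSpan.

Section LieGroup.
Context {R : realType} {G : topGroupType} {n : nat} (A : atlas R G n).

Definition lie_group : Prop :=
  [/\ smooth_manifold A,
      smooth_map A A setT (fun x : G => x^-1%g),
      continuous (fun p : G * G => (p.1 * p.2)%g) &
      forall i j k, smooth
        [set u : 'rV[R]_(n + n) | exists x y, [/\ dom A i x, dom A j y,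
           dom A k (x * y)%g & u = row_mx (coord A i x) (coord A j y)]]
        (fun u => coord A k (param A i (lsubmx u) * param A j (rsubmx u))%g)].

Local Notation field := (G -> chart A -> 'rV[R]_n).

(* left-invariant vector fields *)
Definition lie_algebra : set field :=
  [set X | forall g x, pushes A A (fun y => (g * y)%g) x (X x) (X (g * x)%g)].

(* Lie bracket of vector fields, D_X Y - D_Y X in coordinates *)
Definition bracket (X Y : field) : field := fun x i =>
  let Xi := fun u => X (param A i u) i in
  let Yi := fun u => Y (param A i u) i in
  let u := coord A i x in
  if `[< dom A i x >] then 'D_(Xi u) Yi u - 'D_(Yi u) Xi u else 0.

(* Z = Ad(g) Y *)
Definition adjoint (g : G) (Y Z : field) : Prop :=
  [/\ lie_algebra Y, lie_algebra Z &
    forall x, pushes A A (fun y => (g * y * g^-1)%g) x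
                     (Y x) (Z (g * x * g^-1)%g)].

Definition lie_ideal (I : set field) : Prop :=
  [/\ I `<=` lie_algebra, I 0,
      forall (a : R) X Y, I X -> I Y -> I (a *: X + Y) &
      forall X Y, lie_algebra X -> I Y -> I (bracket X Y)].

Definition derived (I : set field) : set field :=
  span [set Z | exists X Y, [/\ I X, I Y & Z = bracket X Y]].

Definition solvable_ideal (I : set field) : Prop :=
  lie_ideal I /\ exists k, iter k derived I `<=` [set 0].

Definition semisimple_lie_group : Prop :=
  lie_group /\ forall I, solvable_ideal I -> I `<=` [set 0].

Definition ad_eigenspace (X : field) (lam : R) : set field :=
  [set Z | lie_algebra Z /\ bracket X Z = lam *: Z].

(* ad X is diagonalizable over R *)
Definition real_semisimple (X : field) : Prop :=
  lie_algebra X /\ lie_algebra `<=` span (\bigcup_lam ad_eigenspace X lam).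

Definition parabolic_subalgebra (X : field) : set field :=
  span (\bigcup_(lam in [set lam | 0 <= lam]) ad_eigenspace X lam).

Definition normalizer (p : set field) : set G :=
  [set g | forall Y Z, adjoint g Y Z -> (p Y <-> p Z)].

Definition opposite_parabolics (Pp Pm : set G) : Prop :=
  exists X, [/\ real_semisimple X,
    Pp = normalizer (parabolic_subalgebra X) &
    Pm = normalizer (parabolic_subalgebra (- X))].

Definition parabolic_subgroup (P : set G) : Prop :=
  exists2 X, real_semisimple X & P = normalizer (parabolic_subalgebra X).

(* H lies between the fixed group of an involutive automorphism and its
   identity component *)
Definition symmetric_subgroup (H : set G) : Prop :=
  [/\ H 1%g, forall x y, H x -> H y -> H (x * y)%g,
      forall x, H x -> H x^-1%g &
      exists sigma : G -> G, [/\ smooth_map A A setT sigma,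
        forall x y, sigma (x * y)%g = (sigma x * sigma y)%g,
        involutive sigma,
        H `<=` [set x | sigma x = x] &
        connected_component [set x | sigma x = x] 1%g `<=` H]].

End LieGroup.

Definition homogeneous (G : topGroupType) (H : set G) : Type :=
  {C : set G | exists g, C = [set (g * h)%g | h in H]}.

Section Homogeneous.
Context {G : topGroupType} (H : set G).
Local Notation X := (homogeneous H).

Definition coset_of (g : G) : X :=
  exist _ [set (g * h)%g | h in H] (ex_intro _ g erefl).

Lemma translate_subproof (g : G) (C : X) :
  exists g', [set (g * x)%g | x in sval C] = [set (g' * h)%g | h in H].
Proof.
case: C => /= _ [k ->]; exists (g * k)%g; rewrite eqEsubset; split => x.
  by case=> _ [h Hh <-] <-; exists h => //; rewrite mulgA.
by case=> h Hh <-; exists (k * h)%g; rewrite ?mulgA//; exists h.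
Qed.

Definition translate (g : G) (C : X) : X :=
  exist _ [set (g * x)%g | x in sval C] (translate_subproof g C).

Definition homogeneous_open (W : set X) : Prop := open (coset_of @^-1` W).

Lemma homogeneous_openT : homogeneous_open setT.
Proof. by rewrite /homogeneous_open preimage_setT; exact: openT. Qed.

Lemma homogeneous_openI : setI_closed homogeneous_open.
Proof.
by move=> V W oV oW; rewrite /homogeneous_open preimage_setI; exact: openI.
Qed.

Lemma homogeneous_open_bigU (I : Type) (f : I -> set X) :
  (forall i, homogeneous_open (f i)) -> homogeneous_open (\bigcup_i f i).
Proof.
move=> fo; rewrite /homogeneous_open preimage_bigcup.
by apply: bigcup_open => i _; exact: fo.
Qed.

HB.instance Definition _ := gen_eqMixin X.
HB.instance Definition _ := gen_choiceMixin X.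
HB.instance Definition _ := isOpenTopological.Build X
  homogeneous_openT homogeneous_openI homogeneous_open_bigU.

(* The smooth structure [B] of G / H is characterized by the projection being
   a submersion. *)
Definition homogeneous_manifold {R : realType} {n m}
    (A : atlas R G n) (B : atlas R X m) : Prop :=
  [/\ smooth_manifold B, smooth_map A B setT coset_of &
    forall g w, tangent B (coset_of g) w ->
      exists v, pushes A B coset_of g v w].

End Homogeneous.

Section Anosov.
Context {R : realType} {Gam : groupType} (S : seq Gam) {G : topGroupType}.
Local Notation bd := (@group_boundary R Gam S).

(* (x, y) lies in an open orbit of the diagonal action of G *)
Definition transverse {Pp Pm : set G} (x : homogeneous Pp) (y : homogeneous Pm)
    : Prop :=
  open [set z : homogeneous Pp * homogeneous Pm |
          exists g, z = (translate g x, translate g y)].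

Definition boundary_equivariant {P : set G} (rho : Gam -> G)
    (xi : bd -> homogeneous P) : Prop :=
  forall g p q, boundary_translate g p q -> xi q = translate (rho g) (xi p).

(* N y, for y in Y, is a continuous equivariant family of norms on the tangent
   spaces at the points x y of G / P *)
Definition norm_family {Y : metricType R} (F : flow_space S Y) (rho : Gam -> G)
    {P : set G} {m} (B : atlas R (homogeneous P) m) (x : Y -> homogeneous P)
    (N : Y -> (chart B -> 'rV[R]_m) -> R) : Prop :=
  [/\ forall y v, tangent B (x y) v -> 0 <= N y v /\ (N y v = 0 -> v = 0),
      forall y (a : R) v, tangent B (x y) v -> N y (a *: v) = `|a| * N y v,
      forall y v w, tangent B (x y) v -> tangent B (x y) w ->
        N y (v + w) <= N y v + N y w,
      forall i y (u : 'rV[R]_m), dom B i (x y) ->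
        {for (y, u), continuous (fun p : Y * 'rV[R]_m =>
                       N p.1 (tangent_of B i (x p.1) p.2))} &
      forall g y v w, pushes B B (translate (rho g)) (x y) v w ->
        N (fs_act F g y) w = N y v].

Definition contracts {Y : metricType R} {P : set G} {m}
    (B : atlas R (homogeneous P) m) (x : Y -> homogeneous P)
    (N : Y -> (chart B -> 'rV[R]_m) -> R) (flow : R -> Y -> Y) : Prop :=
  exists C c : R, [/\ 0 < C, 0 < c &
    forall (t : R) y e, 0 <= t -> tangent B (x y) e ->
      N (flow t y) e <= C * expR (- c * t) * N y e].

Arguments norm_family {Y} F rho {P m} B x N.
Arguments contracts {Y P m} B x N flow.

Definition anosov (rho : Gam -> G) {Pp Pm : set G} {np nm}
    (Bp : atlas R (homogeneous Pp) np) (Bm : atlas R (homogeneous Pm) nm)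
    : Prop :=
  exists (Y : metricType R) (F : flow_space S Y)
         (xip : bd -> homogeneous Pp) (xim : bd -> homogeneous Pm),
  [/\ continuous xip /\ continuous xim,
      boundary_equivariant rho xip /\ boundary_equivariant rho xim,
      forall p q : bd, p <> q -> transverse (xip p) (xim q),
      exists2 N, norm_family F rho Bp (xip \o fs_pos F) N
        & contracts Bp (xip \o fs_pos F) N (fun t => fs_flow F (- t)) &
      exists2 N, norm_family F rho Bm (xim \o fs_neg F) N
        & contracts Bm (xim \o fs_neg F) N (fs_flow F)].

End Anosov.

(* [a] need only preserve the subset D of T *)
Definition properly_discontinuous {I : Type} {T : topologicalType}
    (D : set T) (a : I -> T -> T) : Prop :=
  forall K, K `<=` D -> compact K ->
    finite_set [set g | (a g @` K) `&` K !=set0].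

Definition domain_of_discontinuity {Gam : Type} {G : topGroupType}
    {H : set G} (rho : Gam -> G) (M : set (homogeneous H)) : Prop :=
  [/\ open M, forall g x, M x -> M (translate (rho g) x) &
      properly_discontinuous M (fun g => translate (rho g))].

Section ComplexCurve.
Context {R : realType}.

Definition to_complex (v : 'rV[R]_2) : R[i]^o := v 0 0 +i* v 0 1.
Definition of_complex (z : R[i]^o) : 'rV[R]_2 :=
  \row_(k < 2) (if k == 0 then complex.Re z else complex.Im z).

Definition holomorphic (U : set 'rV[R]_2) (f : 'rV[R]_2 -> 'rV[R]_2) : Prop :=
  forall u, U u -> derivable (to_complex \o f \o of_complex) (to_complex u) 1.

(* complex charts, read in R^2, on the open subset M of the manifold (T, B),
   compatible with the smooth structure of T *)
Definition complex_curve {T : topologicalType} {m} (B : atlas R T m)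
    (M : set T) (A : atlas R T 2) : Prop :=
  [/\ open M /\ M !=set0, smooth_atlas M A,
      smooth_map A B M id /\ smooth_map B A M id &
      forall i j, holomorphic (coord A i @` (dom A i `&` dom A j))
                              (coord A j \o param A i)].

Definition holomorphic_map {T : topologicalType} (M : set T) (A : atlas R T 2)
    (f : T -> T) : Prop :=
  (forall x, M x -> {for x, continuous f}) /\
  forall i j, holomorphic (coord A i @` (dom A i `&` f @^-1` dom A j))
                          (coord A j \o f \o param A i).

Definition biholomorphism {T : topologicalType} (M : set T) (A : atlas R T 2)
    (f : T -> T) : Prop :=
  exists f' : T -> T, [/\ forall x, M x -> M (f x) /\ f' (f x) = x,
    forall x, M x -> M (f' x) /\ f (f' x) = x,
    holomorphic_map M A f & holomorphic_map M A f'].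

(* Pairs (u, w) stand for elements u + i w of the complexified tangent space *)
Definition ctangent {T : Type} (A : atlas R T 2) : Type :=
  ((chart A -> 'rV[R]_2) * (chart A -> 'rV[R]_2))%type.

(* multiplication by i in the complex charts *)
Definition complex_structure {T : Type} {A : atlas R T 2}
    (u : chart A -> 'rV[R]_2) : chart A -> 'rV[R]_2 :=
  fun k => of_complex ('i%C * to_complex (u k)).

(* T^{1,0} is the eigenspace J (u + i w) = i (u + i w) *)
Definition tangent10 {T : Type} (A : atlas R T 2) (x : T) : set (ctangent A) :=
  [set e | [/\ tangent A x e.1, tangent A x e.2,
     complex_structure e.1 = - e.2 & complex_structure e.2 = e.1]].

(* total space of the pullback by g : M -> M of T^{1,0}M *)
Definition pullback10 {T : Type} (M : set T) (A : atlas R T 2) (g : T -> T) :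
    set (T * (T * ctangent A)) :=
  [set e | [/\ M e.1, e.2.1 = g e.1 & tangent10 e.2.1 e.2.2]].

End ComplexCurve.
Arguments tangent10 {R T} A x.
Arguments pullback10 {R T} M A g.

Section ImageGroup.
Context {Gam : groupType} {G : topGroupType} (rho : {multiplicative Gam -> G}).

Definition image_group : Type := {g : G | exists a, g = rho a}.

Definition to_image (a : Gam) : image_group :=
  exist _ (rho a) (ex_intro _ a erefl).

Definition image_one : image_group := to_image 1%g.

Lemma image_mul_subproof (g h : image_group) :
  exists a, (sval g * sval h)%g = rho a.
Proof.
by case: g h => [x [a xE]] [y [b yE]]; exists (a * b)%g; rewrite /= xE yE gmulfM.
Qed.

Definition image_mul (g h : image_group) : image_group :=
  exist _ (sval g * sval h)%g (image_mul_subproof g h).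

End ImageGroup.

Section LineBundles.
Context {R : realType} {Gam : groupType} {G : topGroupType}
  (rho : {multiplicative Gam -> G}) {H : set G}
  (M : set (homogeneous H)) (A : atlas R (homogeneous H) 2).
Local Notation image := (image_group rho).

Definition bundle (g : image) := pullback10 M A (translate (sval g)).

Definition bundle_gen : Type :=
  {E : set (homogeneous H * (homogeneous H * ctangent A)) |
     exists g, E = bundle g}.

HB.instance Definition _ := gen_eqMixin bundle_gen.
HB.instance Definition _ := gen_choiceMixin bundle_gen.

Definition gen (g : image) : bundle_gen :=
  exist _ (bundle g) (ex_intro _ g erefl).

(* one generator for each element of rho(Gam) up to equality on M *)
Lemma gen_eqP (g h : image) : gen g = gen h <->
  forall x, M x -> translate (sval g) x = translate (sval h) x.
Proof.
split=> [/(congr1 sval) /= E x Mx|E]; last first.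
  apply: eq_exist => /=; rewrite eqEsubset.
  by split=> -[x [y e]] [/= Mx -> te]; split=> //=; rewrite E.
have J0 : complex_structure (0 : chart A -> 'rV[R]_2) = 0.
  apply/funext => k; apply/rowP => j.
  by rewrite /complex_structure /to_complex !mxE /= !mulr0 subr0 addr0 if_same.
have T0 y : tangent A y 0.
  by split=> // i j _ _ /=; rewrite derive0.
have : bundle g (x, (translate (sval g) x, (0, 0))).
  by split=> //=; split; rewrite //= J0 ?oppr0.
by rewrite E => -[].
Qed.

Definition free_abelian : Type := {freeg bundle_gen / int}.

HB.instance Definition _ := GRing.Zmodule.on free_abelian.

Definition line_bundle (g : image) : free_abelian := << gen g >>.

(* g . E^h = E^(g h); the choice of h is irrelevant by gen_eqP *)
Definition act_gen (g : image) (E : bundle_gen) : bundle_gen :=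
  gen (image_mul g (sval (cid (svalP E)))).

(* Each occurrence of a generator in a reduced expression is replaced. *)
Definition act_free (g : image) : free_abelian -> free_abelian :=
  fglift (fun E => << act_gen g E >> : {freeg bundle_gen / int}).

End LineBundles.
Arguments line_bundle {R Gam G} rho {H} M A g.
Arguments act_free {R Gam G} rho {H} M A g x.

(* neither indiscrete nor discrete *)
Definition nontrivial_topology (T : topologicalType) : Prop :=
  ~ (forall U : set T, open U -> U = set0 \/ U = setT) /\
  ~ (forall U : set T, open U).

(* Main.v *)
(* The elements of Gam act on the generators E^g through left translations of
   the group of transformations of M, so injectively, and a gam sending E^h to
   E^g maps h(p) to g(p) for every p in M; proper discontinuity on M allows
   only finitely many such gam. A nonzero element of F^ab has a finite nonempty
   support, so only finitely many gam send it to a given element. Now let F^ab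
   be the one-point compactification of the discrete set F^ab \ {O}, with O at
   infinity: the action is continuous, being by bijections that fix O, and the
   compact sets avoiding O are finite. *)
Require Import Defs.
From HB Require Import structures.
From mathcomp Require Import all_boot all_order all_algebra.
From mathcomp Require Import freeg.
From mathcomp Require Import all_classical all_reals all_analysis.

Set Implicit Arguments.
Unset Strict Implicit.
Unset Printing Implicit Defensive.

Import GRing.Theory numFieldTopology.Exports numFieldNormedType.Exports.

Local Open Scope classical_set_scope.
Local Open Scope ring_scope.

(** * Functoriality of free modules in their generators *)

Section FreegMap.
Context {A : nzRingType}.

HB.instance Definition _ (K : choiceType) (V : lmodType A) (f : K -> V) :=
  GRing.isZmodMorphism.Build {freeg K / A} V (fglift f) (lift_is_additive f).

(** The action on F^ab is [fgmap] of the action on generators, so the group laws follow from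
    functoriality. *)
Definition fgmap {K L : choiceType} (f : K -> L) :
    {freeg K / A} -> {freeg L / A} :=
  fglift (fun k => << f k >> : {freeg L / A}).

HB.instance Definition _ (K L : choiceType) (f : K -> L) :=
  GRing.Additive.on (@fgmap K L f).

Lemma fgmapU {K L : choiceType} (f : K -> L) (c : A) (k : K) :
  fgmap f << c *g k >> = << c *g f k >>.
Proof.
by apply/eqP/freeg_eqP => l; rewrite /fgmap liftU coeff_fgscale !coeffU mul1r.
Qed.

Lemma fgmap_id (K : choiceType) (f : K -> K) : f =1 id -> fgmap f =1 id.
Proof.
move=> fE; elim/freeg_ind_dom0 => [|c k D _ _ IH]; first exact: raddf0.
by rewrite raddfD /= IH fgmapU fE.
Qed.

Lemma fgmap_comp (K L N : choiceType) (f : L -> N) (g : K -> L) (h : K -> N) :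
  h =1 f \o g -> fgmap h =1 fgmap f \o fgmap g.
Proof.
move=> hE; elim/freeg_ind_dom0 => [|c k D _ _ IH] /=; first by rewrite !raddf0.
by rewrite !raddfD /= IH !fgmapU hE.
Qed.

(** An injective [f] never merges two generators, so no coefficients are added together or
    cancel. *)
Lemma coeff_fgmap {K L : choiceType} (f : K -> L) (D : {freeg K / A}) (k : K) :
  injective f -> coeff (f k) (fgmap f D) = coeff k D.
Proof.
move=> f_inj; elim/freeg_ind_dom0: D => [|c k' D _ _ IH].
  by rewrite raddf0 !coeff0.
by rewrite raddfD /= !coeffD IH fgmapU !coeffU (inj_eq f_inj).
Qed.

End FreegMap.

(** The multiples of one generator are told apart by their coefficient at [k]. *)
Lemma infinite_freeg_int (K : choiceType) (k : K) :
  infinite_set [set: {freeg K / int}].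
Proof.
apply: (@sub_infinite_set _ [set << k >> *+ n | n in [set: nat]]) => //.
rewrite (eq_finite_set (inj_card_eq _)); first exact: infinite_nat.
move=> i j _ _ /(congr1 (coeff k)).
by rewrite !coeffMn coeffU eqxx mulr1 !natz => -[].
Qed.

(* The one-point compactification of the discrete space T \ {a}, a being the
   point at infinity. *)
Definition compactified_at (T : choiceType) (a : T) : Type := T.

(** * Topology of the one-point compactification *)

Section CompactifiedAt.
Context {T : choiceType} (a : T).
Local Notation X := (compactified_at a).

Definition compactified_open (U : set X) : Prop := U a -> cofinite_set U.

Lemma compactified_openT : compactified_open setT.
Proof. by move=> _; exact: cofinite_setT. Qed.

Lemma compactified_openI : setI_closed compactified_open.
Proof. by move=> U V oU oV [/oU fU /oV fV]; rewrite cofinite_setI. Qed.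

Lemma compactified_open_bigU (I : Type) (f : I -> set X) :
  (forall i, compactified_open (f i)) -> compactified_open (\bigcup_i f i).
Proof.
move=> fo [i _ /fo]; apply: sub_cofinite_set => x; exact: bigcup_sup.
Qed.

HB.instance Definition _ := Choice.on X.
HB.instance Definition _ := isPointed.Build X a.
HB.instance Definition _ := isOpenTopological.Build X
  compactified_openT compactified_openI compactified_open_bigU.

Lemma compactified_openE (U : set X) : open U = (U a -> cofinite_set U).
Proof. by []. Qed.

Lemma open_compactified (U : set X) : ~ U a -> open U.
Proof. by rewrite compactified_openE => Ua /Ua. Qed.

(** If [[set a]] were open it would be cofinite, making [T] finite. Any other singleton is open,
    nonempty, and misses [a]. *)
Lemma compactified_nontrivial : infinite_set [set: T] -> nontrivial_topology X.
Proof.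
move=> Tinf; split=> [triv|discr]; last first.
  apply: Tinf; rewrite -(setvU [set a]) finite_setU; split; last first.
    exact: finite_set1.
  by have := discr [set a]; rewrite compactified_openE; exact.
have [x xa] : exists x, x <> a.
  apply: contrapT => nx; apply: Tinf.
  apply: sub_finite_set (finite_set1 a) => x _ /=.
  by apply: contrapT => xa; apply: nx; exists x.
case: (triv [set x]) => [|/seteqP[/(_ x erefl)]|/seteqP[_ /(_ a I) /esym]] //.
exact/open_compactified/nesym.
Qed.

(** The complement of the preimage of [U] lies in the image under [f'] of the complement of [U],
    hence is finite when the latter is. *)
Lemma compactified_continuous (f f' : X -> X) :
  cancel f f' -> f a = a -> continuous f.
Proof.
move=> fK fa; apply/continuousP => U; rewrite !compactified_openE => oU /=.
rewrite /preimage /= fa => /oU fU.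
apply: sub_finite_set (finite_image f' fU) => x /= nUfx.
by exists (f x).
Qed.

Lemma compactified_compact_finite (K : set X) :
  ~ K a -> compact K -> finite_set K.
Proof.
(* The singletons of points of [K] are open because [K] misses [a]; a finite subcover lists [K]. *)
move=> Ka; rewrite compact_cover => /(_ X K (fun x => [set x])) [].
- by move=> x Kx; apply: open_compactified => /= ax; apply: Ka; rewrite ax.
- by move=> x Kx; exists x.
move=> D _ KD; apply: sub_finite_set (finite_fset D) => x /KD[y yD ->] //.
Qed.

End CompactifiedAt.

Lemma translateM {G : topGroupType} (H : set G) (g h : G) (C : homogeneous H) :
  translate (g * h)%g C = translate g (translate h C).
Proof.
apply: eq_exist => /=; rewrite eqEsubset.
split=> [_ [x Cx <-]|_ [_ [x Cx <-] <-]].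
  by exists (h * x)%g; [exists x|rewrite mulgA].
by exists x => //; rewrite mulgA.
Qed.

(** * The action on generators and on F^ab *)

Section Action.
Context {R : realType} {Gam : groupType} {G : topGroupType}
  (rho : {multiplicative Gam -> G}) {H : set G}
  (M : set (homogeneous H)) (A : atlas R (homogeneous H) 2).
Hypothesis M_stable : forall a x, M x -> M (translate (rho a) x).
Local Notation image := (image_group rho).
Local Notation act_gen := (act_gen (M := M) (A := A)).
Local Notation act_free := (act_free rho M A).

Lemma to_image_surj (g : image) : exists a, g = to_image rho a.
Proof. by case: g => x [a xE]; exists a; apply: eq_exist. Qed.

Lemma gen_surj (E : bundle_gen rho M A) : exists g, E = gen M A g.
Proof. by case: E => E [g EE]; exists g; apply: eq_exist. Qed.

Lemma image_mulA (g h k : image) :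
  image_mul g (image_mul h k) = image_mul (image_mul g h) k.
Proof. by apply: eq_exist; rewrite /= mulgA. Qed.

Lemma image_mul1 (g : image) : image_mul (image_one rho) g = g.
Proof.
have [a ->] := to_image_surj g.
by apply: eq_exist; rewrite /= -gmulfM mul1g.
Qed.

Lemma image_mulV (a : Gam) :
  image_mul (to_image rho a^-1%g) (to_image rho a) = image_one rho.
Proof. by apply: eq_exist; rewrite /= -gmulfM mulVg. Qed.

(** The representative [k] chosen in [act_gen] may differ from [h], but both agree on [M], and so do
    their composites with [g]. *)
Lemma act_genE (g h : image) : act_gen g (gen M A h) = gen M A (image_mul g h).
Proof.
rewrite /act_gen; case: cid => /= k kE; apply/Defs.gen_eqP => x Mx /=.
have /Defs.gen_eqP E : gen M A k = gen M A h by apply: eq_exist; rewrite -kE.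
by rewrite !translateM E.
Qed.

Lemma act_gen1 : act_gen (image_one rho) =1 id.
Proof. by move=> E; have [g ->] := gen_surj E; rewrite act_genE image_mul1. Qed.

Lemma act_genM (g h : image) :
  act_gen (image_mul g h) =1 act_gen g \o act_gen h.
Proof.
by move=> E; have [k ->] := gen_surj E; rewrite /= !act_genE image_mulA.
Qed.

Lemma act_gen_inj (g : image) : injective (act_gen g).
Proof.
have [a ->] := to_image_surj g.
apply: (can_inj (g := act_gen (to_image rho a^-1%g))) => E.
by have /= <- := act_genM _ _ E; rewrite image_mulV act_gen1.
Qed.

Lemma act_freeE (g : image) : act_free g = fgmap (act_gen g).
Proof. by []. Qed.

Lemma act_freeD (g : image) : {morph act_free g : x y / x + y}.
Proof. by move=> x y; rewrite act_freeE raddfD. Qed.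

Lemma act_free0 (g : image) : act_free g 0 = 0.
Proof. by rewrite act_freeE raddf0. Qed.

Lemma act_free1 : act_free (image_one rho) =1 id.
Proof. exact: fgmap_id act_gen1. Qed.

Lemma act_freeM (g h : image) :
  act_free (image_mul g h) =1 act_free g \o act_free h.
Proof. exact: fgmap_comp (act_genM g h). Qed.

Lemma act_free_line_bundle (g h : image) :
  act_free g (line_bundle rho M A h) = line_bundle rho M A (image_mul g h).
Proof. by rewrite act_freeE fgmapU act_genE. Qed.

Lemma act_freeK (a : Gam) :
  cancel (act_free (to_image rho a)) (act_free (to_image rho a^-1%g)).
Proof.
by move=> x; have /= <- := act_freeM _ _ x; rewrite image_mulV act_free1.
Qed.

Lemma act_free_bij (g : image) : bijective (act_free g).
Proof.
have [a ->] := to_image_surj g.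
exists (act_free (to_image rho a^-1%g)); first exact: act_freeK.
(* The second cancellation is the first one applied to the inverse of [a]. *)
by move=> x; rewrite -{1}(invgK a) act_freeK.
Qed.

(** * Finiteness of transporters, counted in [Gam] and hence also in its image *)

Hypothesis M_discontinuous :
  properly_discontinuous M (fun a => translate (rho a)).
Hypothesis M_neq0 : M !=set0.

(** Proper discontinuity is applied to the compact set made of [p] and [q], which meets its
    translate at [q]. *)
Lemma finite_translate_eq (p q : homogeneous H) : M p -> M q ->
  finite_set [set a | translate (rho a) p = q].
Proof.
move=> Mp Mq; have := @M_discontinuous [set p; q].
move=> /(_ _ (finite_compact (finite_set2 p q))) finK.
apply: sub_finite_set (finK _) => [a /= apq|x [->|->] //].
by exists q; split; [exists p; [left|]|right].
Qed.

(** With [E] and [E'] the bundles of [g] and [h], evaluation at one point [p] of [M] shows that [a]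
    carries g(p) to h(p), both in [M] by stability. *)
Lemma finite_act_gen_eq (E E' : bundle_gen rho M A) :
  finite_set [set a | act_gen (to_image rho a) E = E'].
Proof.
have [p Mp] := M_neq0.
have [g ->] := gen_surj E; have [h ->] := gen_surj E'.
have [b gE] := to_image_surj g; have [c hE] := to_image_surj h.
apply: sub_finite_set (finite_translate_eq (M_stable b Mp) (M_stable c Mp)).
move=> a /=; rewrite act_genE gE hE => /Defs.gen_eqP/(_ p Mp) /= <-.
by rewrite translateM.
Qed.

(** A generator [E] in the support of [x] must land in the finite support of [y], and each possible
    target is reached by finitely many [a]. *)
Lemma finite_act_free_eq (x y : free_abelian rho M A) : x <> 0 ->
  finite_set [set a | act_free (to_image rho a) x = y].
Proof.
move=> /eqP; rewrite -dom_eq0; case xE: (dom x) => [//|E s] _.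
have Ex : coeff E x != 0 by rewrite -mem_dom xE mem_head.
pose F E' := [set a | act_gen (to_image rho a) E = E'].
apply: (@sub_finite_set _ _ (\bigcup_(E' in [set` dom y]) F E')); last first.
  apply: bigcup_finite => [|E' _]; first exact: finite_seq.
  exact: finite_act_gen_eq.
move=> a /= axy; exists (act_gen (to_image rho a) E) => //=.
(* The coefficient of [y] at the image of [E] equals that of [x] at [E], which is nonzero. *)
by rewrite mem_dom -axy act_freeE coeff_fgmap//; exact: act_gen_inj.
Qed.

Lemma finite_act_free_meets (K : set (free_abelian rho M A)) :
  K `<=` [set x | x <> 0] -> finite_set K ->
  finite_set [set a | (act_free (to_image rho a) @` K) `&` K !=set0].
Proof.
move=> K0 finK; pose F x y := [set a | act_free (to_image rho a) x = y].
apply: (@sub_finite_set _ _ (\bigcup_(x in K) \bigcup_(y in K) F x y)).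
  by move=> a [y [[x Kx axy] Ky]]; exists x => //; exists y.
apply: bigcup_finite => // x /K0 x0; apply: bigcup_finite => // y _.
exact: finite_act_free_eq.
Qed.

End Action.

Theorem theorem1p4 (R : realType)
    (Gam : groupType) (S : seq Gam)
    (G : topGroupType) (n : nat) (AG : atlas R G n)
    (Pp Pm : set G)
    (np : nat) (Bp : atlas R (homogeneous Pp) np)
    (nm : nat) (Bm : atlas R (homogeneous Pm) nm)
    (H : set G) (m : nat) (AX : atlas R (homogeneous H) m)
    (rho : {multiplicative Gam -> G})
    (M : set (homogeneous H)) (AM : atlas R (homogeneous H) 2) :
  generates S -> word_hyperbolic (R := R) S ->
  semisimple_lie_group AG ->
  opposite_parabolics AG Pp Pm ->
  homogeneous_manifold AG Bp -> homogeneous_manifold AG Bm ->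
  anosov S rho Bp Bm ->
  parabolic_subgroup AG H \/ symmetric_subgroup AG H ->
  homogeneous_manifold AG AX ->
  domain_of_discontinuity rho M ->
  complex_curve AX M AM ->
  (forall a, biholomorphism M AM (translate (rho a))) ->
  [/\ forall g : image_group rho, bijective (act_free rho M AM g) /\
        {morph act_free rho M AM g : x y / x + y},
      forall x, act_free rho M AM (image_one rho) x = x,
      forall (g h : image_group rho) x,
        act_free rho M AM (image_mul g h) x
          = act_free rho M AM g (act_free rho M AM h x),
      forall g h : image_group rho,
        act_free rho M AM g (line_bundle rho M AM h)
          = line_bundle rho M AM (image_mul g h) &
      exists t : Topological (free_abelian rho M AM),
        let F := Topological.Pack t in
        [/\ nontrivial_topology F,
            forall g : image_group rho,
              continuous (act_free rho M AM g : F -> F) &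
            properly_discontinuous (T := F)
              [set x | x <> (0 : free_abelian rho M AM)]
              (fun a => act_free rho M AM (to_image rho a))]].
Proof.
move=> _ _ _ _ _ _ _ _ _ [_ M_stable M_disc] [[_ M_neq0] _ _ _] _.
split.
- by move=> g; split; [exact: act_free_bij|exact: act_freeD].
- exact: act_free1.
- exact: act_freeM.
- exact: act_free_line_bundle.
(* [compactified_at] unfolds to its carrier, so its topology is one on F^ab itself. *)
exists (Topological.on (compactified_at (0 : free_abelian rho M AM))) => F.
split.
- apply: compactified_nontrivial.
  exact: infinite_freeg_int (gen M AM (image_one rho)).
- move=> g; have [a ->] := to_image_surj g.
  by apply: compactified_continuous (act_freeK a) _; exact: act_free0.
- move=> K K0 /compactified_compact_finite finK.
  by apply: finite_act_free_meets => //; apply: finK => /K0.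
Qed.
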